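(* Suppose that $K \subset S^3$ is a two-bridge knot with Alexander polynomial $\Delta_K(t)$. If $\pi_1(S^3 \setminus K)$ is bi-orderable, then $\Delta_K(t)$ has a positive real root.
   Context: A group $G$ is called bi-orderable if there exists a strict total ordering $<$ of the elements of $G$ such that $g<h$ implies $fg<fh$ and $gf<hf$ for all $f,g,h\in G$. Two-bridge knots are classified (Schubert) by coprime pairs of odd integers $p,q$ with $0<p<q$; the corresponding knot is written $K_{\frac{p}{q}}$. Its knot group has the presentation $$\pi_1(S^3\setminus K_{\frac{p}{q}}) = \langle a,b \mid aw=wb\rangle,\qquad w=b^{\epsilon_1}a^{\epsilon_2}\cdots b^{\epsilon_{q-2}}a^{\epsilon_{q-1}},\qquad \epsilon_i=(-1)^{\lfloor ip/q\rfloor}.$$ The Alexander polynomial $\Delta_K(t)$ is the usual one with integer coefficients, defined up to multiplication by $\pm t^k$, $k \in \mathbb{Z}$ (which does not affect the existence of a positive real root). *)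

(* Defs.v *)
From HB Require Import structures.
From mathcomp Require Import all_boot all_order all_algebra.
From mathcomp Require Import monoid fraction generic_quotient.
From mathcomp Require Import boolp reals.

Set Implicit Arguments.
Unset Strict Implicit.
Unset Printing Implicit Defensive.

Import Order.TTheory GRing.Theory Num.Theory.

Definition bi_orderable (G : groupType) : Prop :=
  exists lt : G -> G -> Prop,
    [/\ forall g, ~ lt g g,
        forall f g h, lt f g -> lt g h -> lt f h,
        forall g h, g <> h -> lt g h \/ lt h g &
        forall f g h, lt g h -> lt (f * g)%g (f * h)%g /\ lt (g * f)%g (h * f)%g].

(* The letter (i, false) stands for the generator x_i, and (i, true) for its
   inverse. *)
Definition word (n : nat) : Type := seq ('I_n * bool).

Definition letter_inv (n : nat) (l : 'I_n * bool) : 'I_n * bool :=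
  (l.1, ~~ l.2).

Definition word_inv (n : nat) (u : word n) : word n :=
  rev [seq letter_inv l | l <- u].

Record presentation := Presentation {
  ngens : nat;
  relators : seq (word ngens)
}.

(* Equality of words in the group presented by P: the congruence generated by
   free cancellation and by the relators. *)
Inductive word_eq (P : presentation) : word (ngens P) -> word (ngens P) -> Prop :=
| word_eq_refl u : word_eq u u
| word_eq_sym u v : word_eq u v -> word_eq v u
| word_eq_trans v u w : word_eq u v -> word_eq v w -> word_eq u w
| word_eq_cancel u v l : word_eq (u ++ l :: letter_inv l :: v) (u ++ v)
| word_eq_relator u v r : r \in relators P -> word_eq (u ++ r ++ v) (u ++ v).

Section PresentedGroup.
Variable P : presentation.
Local Notation word := (word (ngens P)).
Implicit Types u v w : word.

Definition word_eqb u v : bool := `[< word_eq u v >].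

Lemma word_eqb_equiv : equiv_class_of word_eqb.
Proof.
split=> [u|u v|v u w].
- by apply/asboolP; exact: word_eq_refl.
- by apply/asboolP/asboolP; exact: word_eq_sym.
- move=> /asboolP uv /asboolP vw; apply/asboolP; exact: word_eq_trans uv vw.
Qed.

Canonical word_eqb_equivRel := EquivRelPack word_eqb_equiv.

Definition presented_group : Type := {eq_quot word_eqb_equivRel}%qT.

HB.instance Definition _ := EqQuotient.on presented_group.
HB.instance Definition _ := Choice.on presented_group.

Definition class_of_word (u : word) : presented_group :=
  (\pi_presented_group u)%qT.

Lemma class_of_wordP u v : class_of_word u = class_of_word v <-> word_eq u v.
Proof.
split=> [/eqmodP /asboolP //|uv]; by apply/eqmodP/asboolP.
Qed.

Lemma repr_word_eq u : word_eq (repr (class_of_word u)) u.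
Proof. by apply/class_of_wordP; rewrite /class_of_word reprK. Qed.

Lemma word_eq_cat u u' v v' :
  word_eq u u' -> word_eq v v' -> word_eq (u ++ v) (u' ++ v').
Proof.
move=> uu vv; apply: (@word_eq_trans _ (u' ++ v)).
  elim: uu => {u u'} [u|u u' _|u' u w _ IH1 _ IH2|x y l|x y r rP].
  - exact: word_eq_refl.
  - exact: word_eq_sym.
  - exact: word_eq_trans IH1 IH2.
  - by rewrite -!catA /=; apply: word_eq_cancel.
  - by rewrite -!catA; apply: word_eq_relator.
elim: vv => {v v'} [v|v v' _|v' v w _ IH1 _ IH2|x y l|x y r rP].
- exact: word_eq_refl.
- exact: word_eq_sym.
- exact: word_eq_trans IH1 IH2.
- by rewrite !catA; apply: word_eq_cancel.
- by rewrite !(catA u'); apply: word_eq_relator.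
Qed.

Lemma letter_invK (n : nat) : involutive (@letter_inv n).
Proof. by case=> i e; rewrite /letter_inv /= negbK. Qed.

Lemma word_invK (n : nat) : involutive (@word_inv n).
Proof.
move=> u; rewrite /word_inv map_rev revK -map_comp -[RHS]map_id.
by apply: eq_map => l /=; rewrite letter_invK.
Qed.

Lemma word_eq_invr u : word_eq (u ++ word_inv u) [::].
Proof.
elim: u => [|l u IH]; first exact: word_eq_refl.
have -> : (l :: u) ++ word_inv (l :: u)
          = [:: l] ++ (u ++ word_inv u) ++ [:: letter_inv l].
  by rewrite /word_inv /= rev_cons -cats1 -catA.
apply: (@word_eq_trans _ ([:: l] ++ [::] ++ [:: letter_inv l])).
  apply: (word_eq_cat (word_eq_refl _)).
  by apply: word_eq_cat IH (word_eq_refl _).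
exact: (@word_eq_cancel P [::] [::]).
Qed.

Lemma word_eq_invl u : word_eq (word_inv u ++ u) [::].
Proof. by have := word_eq_invr (word_inv u); rewrite word_invK. Qed.

Lemma word_eq_inv u v : word_eq u v -> word_eq (word_inv u) (word_inv v).
Proof.
move=> uv; apply: (@word_eq_trans _ (word_inv u ++ (v ++ word_inv v))).
  rewrite -{1}[word_inv u]cats0; apply: (word_eq_cat (word_eq_refl _)).
  exact/word_eq_sym/word_eq_invr.
rewrite catA -{2}[word_inv v]cat0s.
apply: (fun h => word_eq_cat h (word_eq_refl _)).
apply: word_eq_trans (word_eq_invl u).
exact: (word_eq_cat (word_eq_refl _) (word_eq_sym uv)).
Qed.

Definition pg_one : presented_group := class_of_word [::].
Definition pg_mul (x y : presented_group) : presented_group :=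
  class_of_word (repr x ++ repr y).
Definition pg_inv (x : presented_group) : presented_group :=
  class_of_word (word_inv (repr x)).

Lemma class_of_wordW (Q : presented_group -> Prop) :
  (forall u, Q (class_of_word u)) -> forall x, Q x.
Proof. by move=> H x; rewrite -[x]reprK; apply: H. Qed.

Lemma pg_mulE u v :
  pg_mul (class_of_word u) (class_of_word v) = class_of_word (u ++ v).
Proof. by apply/class_of_wordP/word_eq_cat; exact: repr_word_eq. Qed.

Lemma pg_invE u : pg_inv (class_of_word u) = class_of_word (word_inv u).
Proof. by apply/class_of_wordP/word_eq_inv; exact: repr_word_eq. Qed.

Lemma pg_mulA : associative pg_mul.
Proof.
by do 3!elim/class_of_wordW=> ?; rewrite !pg_mulE catA.
Qed.

Lemma pg_mul1g : left_id pg_one pg_mul.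
Proof. by elim/class_of_wordW=> u; rewrite pg_mulE. Qed.

Lemma pg_mulg1 : right_id pg_one pg_mul.
Proof. by elim/class_of_wordW=> u; rewrite pg_mulE cats0. Qed.

Lemma pg_mulVg : left_inverse pg_one pg_inv pg_mul.
Proof.
elim/class_of_wordW=> u; rewrite pg_invE pg_mulE.
exact/class_of_wordP/word_eq_invl.
Qed.

Lemma pg_mulgV : right_inverse pg_one pg_inv pg_mul.
Proof.
elim/class_of_wordW=> u; rewrite pg_invE pg_mulE.
exact/class_of_wordP/word_eq_invr.
Qed.

HB.instance Definition _ :=
  isGroup.Build presented_group pg_mulA pg_mul1g pg_mulg1 pg_mulVg pg_mulgV.

End PresentedGroup.

Section AlexanderPolynomial.
Local Open Scope ring_scope.

(* The ring Z[t, t^-1] of integer Laurent polynomials is realized as a subring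
   of the field of fractions of Z[t]. *)
Local Notation K := {fraction {poly int}}.

Definition tvar : K := tofrac 'X.

Definition laurent (f : K) : Prop :=
  exists (r : {poly int}) (k : nat), f = tofrac r / tvar ^+ k.

Definition laurent_dvd (f g : K) : Prop := exists2 h, laurent h & g = h * f.

(* Image under the ring morphism Z[F_n] -> Z[t, t^-1] that sends every
   generator to t of the Fox derivative with respect to x_j, given by
     d(x_i u)    = delta_ij + x_i d(u),
     d(x_i^-1 u) = - delta_ij x_i^-1 + x_i^-1 d(u). *)
Fixpoint fox_deriv (n : nat) (j : 'I_n) (u : word n) : K :=
  match u with
  | [::] => 0
  | (i, false) :: v => (i == j)%:R + tvar * fox_deriv j v
  | (i, true) :: v => - (i == j)%:R * tvar^-1 + tvar^-1 * fox_deriv j v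
  end.

Definition alexander_matrix (P : presentation) :
    'M[K]_(size (relators P), ngens P) :=
  \matrix_(i, j) fox_deriv j (nth [::] (relators P) i).

(* P must be a presentation of a knot group by meridians, so that the
   abelianization sends every generator to t.  The elementary ideal is
   generated by the minors of size n - 1, n being the number of generators,
   and the Alexander polynomial generates the smallest principal ideal of
   Z[t, t^-1] containing it, i.e. is a greatest common divisor of these minors.
   It is thus determined up to a unit +- t^k; the representatives considered
   are those lying in Z[t]. *)
Definition alexander_minor (P : presentation)
    (f : 'I_(ngens P).-1 -> 'I_(size (relators P)))
    (g : 'I_(ngens P).-1 -> 'I_(ngens P)) : K :=
  \det (mxsub f g (alexander_matrix P)).

Definition is_alexander_poly (P : presentation) (D : {poly int}) : Prop :=
  (forall f g, laurent_dvd (tofrac D) (@alexander_minor P f g)) /\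
  (forall d : K, laurent d ->
     (forall f g, laurent_dvd d (@alexander_minor P f g)) ->
     laurent_dvd d (tofrac D)).

End AlexanderPolynomial.

Local Notation gen_a := (ord0 : 'I_2).
Local Notation gen_b := (ord_max : 'I_2).

(* b^e_1 a^e_2 ... b^e_(q-2) a^e_(q-1), where e_i = (-1)^(floor (i p / q)). *)
Definition two_bridge_word (p q : nat) : word 2 :=
  [seq (if odd i then gen_b else gen_a, odd (i * p %/ q)) | i <- iota 1 q.-1].

(* < a, b | a w = w b >, where a and b are meridians; the relation is written
   as the relator a w (w b)^-1. *)
Definition two_bridge_pres (p q : nat) : presentation :=
  let w := two_bridge_word p q in
  @Presentation 2
    [:: ((gen_a, false) :: w) ++ word_inv (rcons w (gen_b, false))].

Definition two_bridge_knot_group (p q : nat) : groupType :=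
  presented_group (two_bridge_pres p q).

(* Main.v *)
Require Import Defs.
From mathcomp Require Import all_boot all_order all_algebra.
From mathcomp Require Import reals.
From mathcomp Require Import monoid fraction generic_quotient.
From mathcomp Require Import boolp classical_sets.
From mathcomp Require Import zify ring lra.

(** Write a, b for the two meridian generators and x_i for the conjugate of
    x = b a^-1 by a^i.  Replacing the order by its converse, one may assume
    x > 1 ([two_bridge_meridians_neq] gives x <> 1, through the reflections of
    a regular q-gon).  The ordering then leaves three possibilities.

    - x_1 and x_0 are each bounded by a power of the other.  Elements bounded
      by powers of x carry the Hoelder map [growth], an additive real-valued
      function with growth x = 1 ([growthM]); its uniqueness forces conjugation
      by a to multiply it by lam = growth x_1 > 0 ([growthJ]).  Thus
      growth x_i = lam^i.
    - x_1 exceeds all powers of x_0, hence x_i is infinitely small with respect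
      to x_j whenever i < j.
    - x_0 exceeds all powers of x_1, and the same holds whenever i > j.

    Reading a word from left to right, every letter b^(+-1) contributes a factor
    x_l^(+-1), where l is the exponent sum reached before b, or after b^-1: the
    level of the letter ([word_val_levels]).  The Fox derivative with respect to
    b is the corresponding sum of the terms +- t^l ([fox_deriv_levels]).  So the
    relator becomes a product of elements x_l^(+-1) that is trivial in the group.
    In the first case, applying growth to it shows that lam is a root of the
    Fox derivative.  In the other two, let N be the highest, respectively the
    lowest, level of the relator, and use the growth relative to x_N: it is 1 on
    x_N and 0 on the other x_l involved, so the exponents at level N sum to 0.
    This is impossible, because the letters of the relator are alternately
    a^(+-1) and b^(+-1): the position of a letter determines the parity of the
    exponent sum before it, so the parity of the level of a letter b^(+-1)
    determines its sign ([b_levels_sign]), and no cancellation can occur at a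
    given level.  It is the same phenomenon that makes the Alexander polynomial
    of an alternating knot alternate.

    Finally the fundamental identity of Fox calculus shows that the derivatives
    with respect to a and b are opposite ([fox_fundamental]).  Hence the
    derivative with respect to b divides all the minors, thus also the
    Alexander polynomial, which inherits the root lam. *)

Set Implicit Arguments.
Unset Strict Implicit.
Unset Printing Implicit Defensive.

Import Order.TTheory GRing.Theory Num.Theory.

Local Notation gen_a := (ord0 : 'I_2).
Local Notation gen_b := (ord_max : 'I_2).

(** * Bi-ordered groups *)

Section IntegerPowers.
Variable G : groupType.
Implicit Types (g h : G) (m n : int) (k : nat).
Local Open Scope group_scope.

Definition expgz g m : G :=
  match m with Posz k => g ^+ k | Negz k => g ^- k.+1 end.

Lemma expgzB g k l : expgz g (k%:Z - l%:Z)%R = g ^+ k / g ^+ l.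
Proof.
case: (leqP l k) => [lk|kl].
  by rewrite subzn //= expgnFr.
have -> : (k%:Z - l%:Z)%R = Negz (l - k).-1 by lia.
rewrite /= prednK ?subn_gt0 // expgnFr; last exact: ltnW.
by rewrite invgF.
Qed.

Lemma int_subn m : exists k l : nat, m = (k%:Z - l%:Z)%R.
Proof. by case: m => k; [exists k, 0%N|exists 0%N, k.+1]; lia. Qed.

Lemma expgzD g m n : expgz g (m + n)%R = expgz g m * expgz g n.
Proof.
have [k [l ->]] := int_subn m; have [k' [l' ->]] := int_subn n.
have -> : (k%:Z - l%:Z + (k'%:Z - l'%:Z) = (k + k')%N%:Z - (l' + l)%N%:Z)%R.
  lia.
have comm : commute (g ^+ k') (g ^- l).
  by apply: commuteV; apply: commuteX2.
by rewrite !expgzB !expgnDr invgM !mulgA -[g ^+ k * _ * _]mulgA comm !mulgA.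
Qed.

Lemma expgzM g m k : expgz g (m * k%:Z)%R = expgz g m ^+ k.
Proof.
elim: k => [|k IH]; first by rewrite mulr0.
by rewrite expgSr -IH -expgzD; congr expgz; lia.
Qed.

Lemma expgzN g m : expgz g (- m)%R = (expgz g m)^-1.
Proof. by apply/esym/mulg1_eq; rewrite -expgzD subrr. Qed.

End IntegerPowers.

Definition biorder (G : groupType) (lt : G -> G -> Prop) : Prop :=
  [/\ forall g, ~ lt g g,
      forall f g h, lt f g -> lt g h -> lt f h,
      forall g h, g <> h -> lt g h \/ lt h g &
      forall f g h, lt g h -> lt (f * g)%g (f * h)%g /\ lt (g * f)%g (h * f)%g].

Section BiOrder.
Variables (G : groupType) (lt : G -> G -> Prop).
Hypothesis lt_biorder : biorder lt.
Implicit Types (f g h X : G) (m n : int) (k : nat).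
Local Open Scope group_scope.

Local Notation "g < h" := (lt g h).
Definition le g h := lt g h \/ g = h.
Local Notation "g <= h" := (le g h).

Lemma bo_irr g : ~ g < g.
Proof. by case: lt_biorder. Qed.

Lemma bo_trans h f g : f < h -> h < g -> f < g.
Proof. by case: lt_biorder => _ tr _ _; apply: tr. Qed.

Lemma bo_total g h : g <= h \/ h < g.
Proof.
case: lt_biorder => _ _ tot _; case: (pselect (g = h)) => [->|/tot]; first by left; right.
by case; [left; left|right].
Qed.

Lemma bo_refl g : g <= g. Proof. by right. Qed.

Lemma bo_ltW g h : g < h -> g <= h. Proof. by left. Qed.

Lemma bo_le_lt_trans h f g : f <= h -> h < g -> f < g.
Proof. by case=> [|->]; [apply: bo_trans|]. Qed.

Lemma bo_lt_le_trans h f g : f < h -> h <= g -> f < g.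
Proof. by move=> fh [|<-]; [apply: bo_trans|]. Qed.

Lemma bo_le_trans h f g : f <= h -> h <= g -> f <= g.
Proof. by case=> [fh hg|->//]; left; apply: bo_lt_le_trans hg. Qed.

Lemma bo_ltNge g h : g < h -> ~ h <= g.
Proof. by move=> gh hg; apply: (@bo_irr g); apply: bo_lt_le_trans hg. Qed.

Lemma bo_ltM2l f g h : g < h -> f * g < f * h.
Proof. by case: lt_biorder => _ _ _ H /(H f) []. Qed.

Lemma bo_ltM2r f g h : g < h -> g * f < h * f.
Proof. by case: lt_biorder => _ _ _ H /(H f) []. Qed.

Lemma bo_leM2l f g h : g <= h -> f * g <= f * h.
Proof. by case=> [/(bo_ltM2l f)|->]; [left|right]. Qed.

Lemma bo_leM2r f g h : g <= h -> g * f <= h * f.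
Proof. by case=> [/(bo_ltM2r f)|->]; [left|right]. Qed.

Lemma bo_leM f f' g g' : f <= f' -> g <= g' -> f * g <= f' * g'.
Proof. by move=> /(bo_leM2r g) H /(bo_leM2l f'); apply: bo_le_trans. Qed.

Lemma bo_leV g h : g <= h -> h^-1 <= g^-1.
Proof.
move=> /(bo_leM2l h^-1) /(bo_leM2r g^-1).
by rewrite -!mulgA mulgV mulg1 mulKg.
Qed.

Lemma bo_leX k g h : g <= h -> g ^+ k <= h ^+ k.
Proof.
move=> gh; elim: k => [|k IH]; first by right.
by rewrite !expgS; apply: bo_leM.
Qed.

Lemma bo_ltX k g h : g < h -> g ^+ k.+1 < h ^+ k.+1.
Proof.
by move=> gh; rewrite !expgS; apply: bo_lt_le_trans (bo_ltM2r _ gh) _;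
  apply/bo_leM2l/bo_leX/bo_ltW.
Qed.

Lemma bo_ge1_expg k g : 1 <= g -> 1 <= g ^+ k.
Proof. by move=> /(bo_leX k); rewrite expg1n. Qed.

Lemma bo_gt1_expg k g : 1 < g -> 1 < g ^+ k.+1.
Proof. by move=> /(bo_ltX k); rewrite expg1n. Qed.

Lemma bo_ltJ f g h : g < h -> g ^ f < h ^ f.
Proof. by move=> gh; apply/bo_ltM2l/bo_ltM2r. Qed.

Lemma bo_leJ f g h : g <= h -> g ^ f <= h ^ f.
Proof. by case=> [/(bo_ltJ f)|->]; [left|right]. Qed.

(** Moving a factor g to the right past any factor g * h can only increase the
    product; sorting the factors of (g * h)^k one way or the other gives the two
    bounds.  They replace commutativity in the additivity of growth. *)
Lemma bo_expgM_between g h k :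
  g * h <= h * g ->
  g ^+ k * h ^+ k <= (g * h) ^+ k /\ (g * h) ^+ k <= h ^+ k * g ^+ k.
Proof.
move=> ghhg.
have comm_le j : g * (g * h) ^+ j <= (g * h) ^+ j * g.
  elim: j => [|j IH]; first by rewrite mulg1 mul1g; right.
  rewrite expgS -[in X in _ <= X]mulgA.
  apply: (@bo_le_trans ((g * h) * (g * (g * h) ^+ j))); last exact: bo_leM2l.
  rewrite [X in X <= _]mulgA [X in _ <= X]mulgA; apply: bo_leM2r.
  by rewrite -[X in _ <= X]mulgA; apply: bo_leM2l.
have swap j : h * (g * h) ^+ j = (h * g) ^+ j * h.
  elim: j => [|j IH]; first by rewrite mulg1 mul1g.
  by rewrite !expgS -[RHS]mulgA -IH !mulgA.
elim: k => [|k [IHl IHr]]; first by rewrite mulg1; split; right.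
split.
  rewrite expgS expgSr -mulgA [g ^+ k * _]mulgA.
  apply: (@bo_le_trans (g * ((g * h) ^+ k * h))); first exact/bo_leM2l/bo_leM2r.
  by rewrite expgSr !mulgA; apply: bo_leM2r.
apply: (@bo_le_trans ((h * g) ^+ k.+1)); first exact: bo_leX.
rewrite [h ^+ _]expgS [g ^+ _]expgSr expgSr.
rewrite [X in X <= _]mulgA -swap -!mulgA; apply: bo_leM2l.
by rewrite [X in _ <= X]mulgA; apply: bo_leM2r.
Qed.

(** The previous lemma for h^-1 and g^-1, inverted. *)
Lemma bo_expgM_between_ge g h k :
  h * g <= g * h ->
  h ^+ k * g ^+ k <= (g * h) ^+ k /\ (g * h) ^+ k <= g ^+ k * h ^+ k.
Proof.
move=> /bo_leV; rewrite !invgM => /(bo_expgM_between k) [lo hi].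
move/bo_leV: lo; move/bo_leV: hi.
by rewrite -!invgM !expVgn -!invgM !invgK.
Qed.

(** * Growth relative to an element *)

Section Powers.
Variable X : G.
Hypothesis X_gt1 : 1 < X.

Lemma bo_expgz_lt m n : (m < n)%R -> expgz X m < expgz X n.
Proof.
move=> mn; have -> : n = (m + (`|n - m|.-1.+1)%:Z)%R by lia.
rewrite expgzD -{1}[expgz X m]mulg1; apply: bo_ltM2l.
exact: bo_gt1_expg.
Qed.

Lemma bo_expgz_leP m n : expgz X m <= expgz X n -> (m <= n)%R.
Proof. by move=> H; rewrite leNgt; apply/negP => /bo_expgz_lt /bo_ltNge. Qed.

(** Being bounded by powers of X, the positivity of X making these exhaust the
    convex subgroup that X generates. *)
Definition powbounded g := exists m n, expgz X m <= g /\ g <= expgz X n.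

Lemma powbounded1 : powbounded 1.
Proof. by exists 0%R, 0%R; split; right. Qed.

Lemma powboundedM g h : powbounded g -> powbounded h -> powbounded (g * h).
Proof.
move=> [m [n [mg gn]]] [m' [n' [mh hn]]]; exists (m + m')%R, (n + n')%R.
by rewrite !expgzD; split; apply: bo_leM.
Qed.

Lemma powboundedV g : powbounded g -> powbounded g^-1.
Proof.
move=> [m [n [mg gn]]]; exists (- n)%R, (- m)%R.
by rewrite !expgzN; split; apply: bo_leV.
Qed.

Lemma powboundedX g k : powbounded g -> powbounded (g ^+ k).
Proof.
move=> gb; elim: k => [|k IH]; first exact: powbounded1.
by rewrite expgS; apply: powboundedM.
Qed.

Lemma powbounded_floor g : powbounded g ->
  exists m, expgz X m <= g /\ g < expgz X (m + 1)%R.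
Proof.
move=> [m [n [mg gn]]].
have mn : (m <= n)%R by apply: bo_expgz_leP; apply: bo_le_trans gn.
have [d nd] : exists d : nat, (n = m + d%:Z)%R by exists `|n - m|%N; lia.
rewrite {}nd {mn n} in gn.
elim: d m mg gn => [|d IH] m mg gn.
  exists m; split=> //; apply: bo_le_lt_trans gn _; apply: bo_expgz_lt; lia.
case: (bo_total (expgz X (m + 1)%R) g) => [mg'|]; last by exists m.
apply: (IH (m + 1)%R) => //.
by have -> : (m + 1 + d%:Z = m + d.+1%:Z)%R by lia.
Qed.

End Powers.

Section Growth.
Variables (R : realType) (X : G).
Hypothesis X_gt1 : 1 < X.
Local Notation powbounded := (powbounded X).

Definition growth_set g : set R :=
  [set r | exists (m : int) (k : nat),
      expgz X m <= g ^+ k.+1 /\ r = (m%:~R / k.+1%:R)%R].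

(** The Hoelder embedding of an Archimedean ordered group into the reals; here it
    is defined on the elements bounded by powers of X, where it vanishes on those
    that are infinitely small with respect to X. *)
Definition growth g : R := sup (growth_set g).

Lemma growth_set_ub g k m : g ^+ k.+1 <= expgz X m ->
  ubound (growth_set g) (m%:~R / k.+1%:R)%R.
Proof.
move=> gm r [m' [k' [gm' ->]]].
have : (m' * k.+1%:Z <= m * k'.+1%:Z)%R.
  apply: (bo_expgz_leP X_gt1); rewrite !expgzM.
  by apply: bo_le_trans (bo_leX k.+1 gm') _; rewrite -expgnA mulnC expgnA; apply: bo_leX.
by rewrite -(ler_int R) ler_pdivlMr ?ltr0n // mulrAC ler_pdivrMr ?ltr0n // !rmorphM /=.
Qed.

Lemma growth_has_sup g : powbounded g -> has_sup (growth_set g).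
Proof.
move=> [m [n [mg gn]]]; split.
  by exists (m%:~R / 1%:R)%R; exists m, 0%N.
by exists (n%:~R / 1%:R)%R; apply: growth_set_ub.
Qed.

Lemma growth_ge g k m : powbounded g ->
  expgz X m <= g ^+ k -> (m%:~R <= k%:R * growth g)%R.
Proof.
case: k => [_|k gb gm].
  by move/(bo_expgz_leP (n := 0%R) X_gt1); rewrite mul0r -(ler_int R).
rewrite mulrC -ler_pdivrMr ?ltr0n //; apply: ub_le_sup.
  by have [] := growth_has_sup gb.
by exists m, k.
Qed.

Lemma growth_le g k m : powbounded g ->
  g ^+ k <= expgz X m -> (k%:R * growth g <= m%:~R)%R.
Proof.
case: k => [_|k gb gm].
  by move/(bo_expgz_leP (m := 0%R) X_gt1); rewrite mul0r -(ler_int R).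
rewrite mulrC -ler_pdivlMr ?ltr0n //; apply: ge_sup.
  by have [] := growth_has_sup gb.
exact: growth_set_ub.
Qed.

Lemma growth_floor g k : powbounded g ->
  exists m, [/\ expgz X m <= g ^+ k, g ^+ k <= expgz X (m + 1)%R,
    (m%:~R <= k%:R * growth g)%R & (k%:R * growth g <= m%:~R + 1)%R].
Proof.
move=> gb; have [m [mg gm]] := powbounded_floor X_gt1 (powboundedX k gb).
exists m; split=> //; first exact: bo_ltW; first exact: growth_ge.
by have := growth_le gb (bo_ltW gm); rewrite rmorphD.
Qed.

(** The growth of g is only known up to an error 1/k from g^k; real numbers
    compared through such estimates are identified by this criterion. *)
Lemma archi_eq (x y c : R) :
  (forall k : nat, (`|k%:R * (x - y)| <= c)%R) -> x = y.
Proof.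
move=> H; apply/eqP; rewrite -subr_eq0 -normr_le0 leNgt; apply/negP => xy.
have := archi_boundP (x := (c / `|x - y|)%R).
have c0 : (0 <= c)%R by have := H 0%N; rewrite mul0r normr0.
rewrite divr_ge0 // ltr_pdivrMr // => /(_ isT).
by rewrite ltNge -[X in (X * _)%R]normr_nat -normrM H.
Qed.

(** If X^m <= g^k <= X^(m+1) and X^n <= h^k <= X^(n+1), then both g^k h^k and
    h^k g^k lie between X^(m+n) and X^(m+n+2), hence so does (g h)^k: additivity
    holds up to 2/k for every k. *)
Lemma growthM g h : powbounded g -> powbounded h ->
  growth (g * h) = (growth g + growth h)%R.
Proof.
move=> gb hb; apply: (@archi_eq _ _ 2%R) => k.
have [m [mg gm lm ml]] := growth_floor k gb.
have [n [nh hn ln nl]] := growth_floor k hb.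
have ghb := powboundedM gb hb.
have [lo hi] : expgz X (m + n)%R <= (g * h) ^+ k /\
               (g * h) ^+ k <= expgz X (m + n + 2)%R.
  have lo1 : expgz X (m + n)%R <= g ^+ k * h ^+ k by rewrite expgzD; apply: bo_leM.
  have lo2 : expgz X (m + n)%R <= h ^+ k * g ^+ k.
    by rewrite addrC expgzD; apply: bo_leM.
  have hi1 : g ^+ k * h ^+ k <= expgz X (m + n + 2)%R.
    have -> : (m + n + 2 = (m + 1) + (n + 1))%R by lia.
    by rewrite expgzD; apply: bo_leM.
  have hi2 : h ^+ k * g ^+ k <= expgz X (m + n + 2)%R.
    have -> : (m + n + 2 = (n + 1) + (m + 1))%R by lia.
    by rewrite expgzD; apply: bo_leM.
  have [gh|/bo_ltW hg] := bo_total (g * h) (h * g).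
    have [l u] := bo_expgM_between k gh.
    by split; [apply: bo_le_trans l|apply: bo_le_trans hi2].
  have [l u] := bo_expgM_between_ge k hg.
  by split; [apply: bo_le_trans l|apply: bo_le_trans hi1].
have := growth_ge ghb lo; have := growth_le ghb hi.
rewrite !rmorphD /= ler_norml; lra.
Qed.

Lemma growth_mono g h : powbounded g -> powbounded h -> g <= h ->
  (growth g <= growth h)%R.
Proof.
move=> gb hb gh; apply: ge_sup; first by have [] := growth_has_sup gb.
move=> r [m [k [mg ->]]]; rewrite ler_pdivrMr ?ltr0n // mulrC.
by apply: growth_ge => //; apply: bo_le_trans mg _; apply: bo_leX.
Qed.

Lemma growth1 : growth 1 = 0%R.
Proof.
have := growthM (@powbounded1 X) (@powbounded1 X).
by rewrite mulg1; lra.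
Qed.

Lemma growthV g : powbounded g -> growth g^-1 = (- growth g)%R.
Proof.
move=> gb; have := growthM gb (powboundedV gb).
by rewrite mulgV growth1; lra.
Qed.

Lemma growthX g k : powbounded g -> growth (g ^+ k) = (k%:R * growth g)%R.
Proof.
move=> gb; elim: k => [|k IH]; first by rewrite mul0r growth1.
by rewrite expgS growthM ?IH -?natr1; [ring| |apply: powboundedX].
Qed.

Lemma powbounded_expgz g m : powbounded g -> powbounded (expgz g m).
Proof.
by case: m => k gb; [|apply: powboundedV]; apply: powboundedX.
Qed.

Lemma growth_expgz g m : powbounded g -> growth (expgz g m) = (m%:~R * growth g)%R.
Proof.
case: m => k gb; first exact: growthX.
by rewrite growthV ?growthX ?NegzE ?mulrNz ?mulNr //; apply: powboundedX.
Qed.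

Lemma powbounded_base : powbounded X.
Proof. by exists 1%R, 1%R; split; right. Qed.

Lemma growth_base : growth X = 1%R.
Proof.
have Xb := powbounded_base.
have := growth_ge (k := 1) (m := 1%R) Xb (bo_refl _).
have := growth_le (k := 1) (m := 1%R) Xb (bo_refl _); rewrite /=; lra.
Qed.

Lemma powbounded_le g k : 1 <= g -> g <= X ^+ k -> powbounded g.
Proof. by move=> g1 gX; exists 0%R, (Posz k). Qed.

Lemma growth_negligible g : 1 <= g -> (forall k, g ^+ k <= X) ->
  powbounded g /\ growth g = 0%R.
Proof.
move=> g1 gX; have gb : powbounded g by apply: (powbounded_le (k := 1)) => //; apply: (gX 1%N).
split=> //; apply: (@archi_eq _ _ 1%R) => k; rewrite subr0.
have := growth_le (m := 1%R) gb (gX k).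
have := growth_ge (m := 0%R) gb (bo_ge1_expg k g1).
rewrite ler_norml; lra.
Qed.

Section Conjugation.
Variable t : G.
Hypothesis Xt_bounded : powbounded (X ^ t).

Lemma expgzJ g m : expgz g m ^ t = expgz (g ^ t) m.
Proof. by case: m => k /=; rewrite ?conjVg conjXg. Qed.

Lemma powboundedJ g : powbounded g -> powbounded (g ^ t).
Proof.
have le_bounded f h f' : powbounded f -> powbounded f' -> f <= h -> h <= f' ->
    powbounded h.
  move=> [m [_ [mf _]]] [_ [n [_ fn]]] fh hf'.
  by exists m, n; split; [apply: bo_le_trans fh|apply: bo_le_trans fn].
move=> [m [n [/(bo_leJ t) mg /(bo_leJ t) gn]]].
by apply: le_bounded mg gn; rewrite expgzJ; apply: powbounded_expgz.
Qed.

(** Conjugating X^m <= g^k <= X^(m+1) by t bounds k times the growth of g^t by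
    m and m+1 times the growth of X^t, so that the two sides differ by at most
    that growth divided by k. *)
Lemma growthJ g : powbounded g -> growth (g ^ t) = (growth (X ^ t) * growth g)%R.
Proof.
move=> gb; apply: (@archi_eq _ _ (growth (X ^ t))) => k.
have [m [/(bo_leJ t) mg /(bo_leJ t) gm lm ml]] := growth_floor k gb.
have gtb := powboundedJ gb; have gktb := powboundedX k gtb.
rewrite expgzJ conjXg in mg; rewrite expgzJ conjXg in gm.
have Xt_ge0 : (0 <= growth (X ^ t))%R.
  rewrite -growth1; apply: growth_mono => //; first exact: powbounded1.
  by rewrite -(conj1g t); apply/bo_leJ/bo_ltW.
have := growth_mono (powbounded_expgz m Xt_bounded) gktb mg.
have := growth_mono gktb (powbounded_expgz (m + 1)%R Xt_bounded) gm.
rewrite !growth_expgz // growthX // rmorphD /= ler_norml => hi lo.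
have lm' := ler_wpM2l Xt_ge0 lm; have ml' := ler_wpM2l Xt_ge0 ml.
move: (growth (X ^ t)) (growth g) (growth (g ^ t)) (m%:~R%R : R) lo hi lm' ml' => *.
lra.
Qed.

End Conjugation.

End Growth.
End BiOrder.

Lemma biorder_converse (G : groupType) (lt : G -> G -> Prop) :
  biorder lt -> biorder (fun g h => lt h g).
Proof.
case=> irr tr tot mul; split=> //.
- by move=> f g h gf hg; apply: tr gf.
- by move=> g h /tot [|]; [right|left].
- by move=> f g h /mul.
Qed.

(** * Levels of a word in two meridians *)

(** Heights are exponent sums of prefixes, shifted by the starting height h.  They
    are natural numbers, so they are meaningful only when h is at least the length
    of the word, which keeps the predecessors away from truncation. *)
Fixpoint final_height (h : nat) (u : word 2) : nat :=
  match u with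
  | [::] => h
  | (_, false) :: v => final_height h.+1 v
  | (_, true) :: v => final_height h.-1 v
  end.

(** The letters b^(+-1) with their levels, true standing for b^-1.  The level of
    b^-1 is the height after it, since a^h b^-1 = x_(h-1)^-1 a^(h-1) while
    a^h b = x_h a^(h+1). *)
Fixpoint b_levels (h : nat) (u : word 2) : seq (nat * bool) :=
  match u with
  | [::] => [::]
  | (i, false) :: v => nseq (i == gen_b) (h, false) ++ b_levels h.+1 v
  | (i, true) :: v => nseq (i == gen_b) (h.-1, true) ++ b_levels h.-1 v
  end.

Lemma final_height_count h u : size u <= h ->
  final_height h u + count snd u = h + count (fun l => ~~ l.2) u.
Proof.
elim: u h => [|[i []] u IH] h //= uh.
  by case: h uh => //= h uh; have := IH h uh; lia.
have : size u <= h.+1 by lia.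
by move=> /IH; lia.
Qed.

Lemma size_b_levels h u : size (b_levels h u) = count (fun l => l.1 == gen_b) u.
Proof.
by elim: u h => [|[i []] u IH] h //=; rewrite size_cat size_nseq IH.
Qed.

Definition gen_at (k : nat) : 'I_2 := if odd k then gen_b else gen_a.

(** In a word whose letters are alternately a^(+-1) and b^(+-1), the height has a
    prescribed parity at each letter b^(+-1); a letter b takes it as its level,
    and b^-1 its predecessor.  Hence letters of the same level have the same
    sign. *)
Lemma b_levels_sign h k u (l : nat * bool) : size u <= h ->
  [seq i.1 | i <- u] = [seq gen_at i | i <- iota k (size u)] ->
  l \in b_levels h u -> l.2 = ~~ odd (l.1 + h + k).
Proof.
elim: u h k => [|[i s] u IH] h k //= uh [-> alt].
have bE : (gen_at k == gen_b) = odd k by rewrite /gen_at; case: odd.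
case: s; rewrite bE mem_cat => /orP [].
- rewrite mem_nseq lt0b => /andP[ok /eqP ->] /=.
  by rewrite !oddD ok; case: h uh => //= h _; case: odd.
- move/(IH h.-1 k.+1) => ->; rewrite ?alt //; last by lia.
  by case: h uh => //= h _; congr (~~ odd _); lia.
- rewrite mem_nseq lt0b => /andP[ok /eqP ->] /=.
  by rewrite !oddD ok; case: odd.
move/(IH h.+1 k.+1) => ->; rewrite ?alt //; last by lia.
by rewrite !addnS !addSn /= negbK.
Qed.

Section WordValue.
Variables (G : groupType) (a b : G).
Local Open Scope group_scope.

Definition gen_val (i : 'I_2) : G := if i == gen_b then b else a.

Fixpoint word_val (u : word 2) : G :=
  match u with
  | [::] => 1
  | (i, s) :: v => (if s then (gen_val i)^-1 else gen_val i) * word_val v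
  end.

Definition conj_gen (i : nat) : G := (b / a) ^ (a^-1 ^+ i).

Lemma conj_genS i : conj_gen i.+1 = conj_gen i ^ a^-1.
Proof. by rewrite /conj_gen expgSr conjgM. Qed.

Lemma conj_gen_mul i : conj_gen i * a ^+ i = a ^+ i * (b / a).
Proof. by rewrite /conj_gen conjgE expVgn invgK -!mulgA mulVg mulg1. Qed.

Fixpoint conj_prod (L : seq (nat * bool)) : G :=
  match L with
  | [::] => 1
  | (i, s) :: L' => (if s then (conj_gen i)^-1 else conj_gen i) * conj_prod L'
  end.

(** Pushing the powers of a to the right turns each letter b^(+-1) into a conjugate
    of (b / a)^(+-1), indexed by its level. *)
Lemma word_val_levels h u : (size u <= h)%N ->
  a ^+ h * word_val u = conj_prod (b_levels h u) * a ^+ final_height h u.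
Proof.
elim: u h => [|[i s] u IH] h uh; first by rewrite mulg1 mul1g.
have uh' : (size u <= h.+1)%N by rewrite ltnW // ltnW.
have ab : i = gen_a \/ i = gen_b.
  by case: i {uh} => [[|[|//]] ?]; [left|right]; apply/val_inj.
case: s uh => /=.
  case: h {uh'} => // h uh; case: ab => -> /=; rewrite /gen_val /= -?IH //.
    by rewrite expgSr -mulgA mulVKg.
  rewrite -mulgA -IH // !mulgA; congr (_ * _).
  apply: (mulgI (conj_gen h)); rewrite mulVKg expgSr !mulgA conj_gen_mul.
  by rewrite -!mulgA mulKg mulgV mulg1.
move=> uh; case: ab => -> /=; rewrite /gen_val /= -?IH //.
  by rewrite mulgA -expgSr.
rewrite -mulgA -IH // expgSr !mulgA conj_gen_mul -!mulgA; congr (_ * _).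
by rewrite mulKg.
Qed.

End WordValue.

(** * The action of a meridian on growth *)

Definition level_sum (A : pzRingType) (v : nat -> A) (L : seq (nat * bool)) : A :=
  (\sum_(l <- L) (-1) ^+ l.2 * v l.1)%R.

(** All the terms at level N have the same sign. *)
Lemma level_sum_indicator_neq0 (R : numDomainType) (L : seq (nat * bool))
    (sgn : nat -> bool) (N : nat) :
  (forall l, l \in L -> l.2 = sgn l.1) -> N \in map fst L ->
  (level_sum (fun i => (i == N)%:R) L != 0 :> R)%R.
Proof.
move=> Lsgn NL.
have -> : (level_sum (fun i => (i == N)%:R) L
           = (-1) ^+ sgn N * (count (fun l => l.1 == N) L)%:R :> R)%R.
  rewrite /level_sum -sum1_count natr_sum big_distrr /= big_mkcond [RHS]big_mkcond /=.
  rewrite !big_seq; apply: eq_bigr => l /Lsgn ->.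
  by case: eqP => [->|]; rewrite ?mulr0.
rewrite mulf_eq0 signr_eq0 /= pnatr_eq0 -lt0n -has_count.
by case/mapP: NL => l lL ->; apply/hasP; exists l => /=.
Qed.

(** Used for both orders on levels, as the dominant level is the highest or the
    lowest one. *)
Lemma maximal_level (L : seq (nat * bool)) (r : nat -> nat -> Prop) :
  L <> [::] -> (forall i j, i != j -> r i j \/ r j i) ->
  (forall j i k, r i j -> r j k -> r i k) ->
  exists2 N, N \in map fst L & forall i, i \in map fst L -> i != N -> r i N.
Proof.
move=> + tot tr; elim: L => // l L' IH _.
case: (pselect (L' = [::])) => [->|/IH [N NL maxN]].
  by exists l.1; rewrite ?mem_head // => i; rewrite inE => ->.
have [lN|] := eqVneq l.1 N.
  exists N; first by rewrite /= inE NL orbT.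
  by move=> i /=; rewrite inE => /predU1P [->|/maxN //]; rewrite lN eqxx.
move=> /tot [lN|Nl].
  exists N; first by rewrite /= inE NL orbT.
  by move=> i /=; rewrite inE => /predU1P [->|/maxN //].
exists l.1; first by rewrite mem_head.
move=> i /=; rewrite inE => /predU1P [->|iL _]; first by rewrite eqxx.
by have [->//|/(maxN _ iL) iN] := eqVneq i N; apply: tr Nl.
Qed.

Section ConjGenerators.
Variables (R : realType) (G : groupType) (lt : G -> G -> Prop).
Hypothesis lt_biorder : biorder lt.
Variables (a b : G) (L : seq (nat * bool)).
Hypothesis L_prod1 : conj_prod a b L = 1%g.
Local Notation x := (conj_gen a b).
Local Open Scope group_scope.

Lemma growth_conj_prod X : lt 1 X -> forall v : nat -> R,
  (forall l, l \in L -> powbounded lt X (x l.1) /\ growth lt R X (x l.1) = v l.1) ->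
  level_sum v L = 0%R.
Proof.
move=> X1 v Lv; rewrite -(growth1 lt_biorder R X1) -L_prod1.
suff [] : powbounded lt X (conj_prod a b L) /\
   growth lt R X (conj_prod a b L) = level_sum v L by move=> _ ->.
elim: L Lv => [|[i s] L' IH] Lv.
  rewrite /level_sum big_nil; split; first exact: powbounded1.
  exact: growth1.
have [xb xv] : powbounded lt X (x i) /\ growth lt R X (x i) = v i.
  exact: (Lv (i, s) (mem_head _ _)).
have [|Lb Lg] := IH; first by move=> l lL; apply: Lv; rewrite inE lL orbT.
rewrite /level_sum big_cons -/(level_sum v L') -Lg /= -xv.
case: s {Lv}; split; try (apply: powboundedM => //; apply: powboundedV => //).
  rewrite growthM ?growthV //=; first by rewrite mulN1r.
  exact: powboundedV.
by rewrite growthM //= mul1r.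
Qed.

(** Relative to x_N, all other factors of the product are infinitely small, so its
    growth is the sum of the exponents at level N, which cannot be 0. *)
Lemma no_dominant_level (sgn : nat -> bool) (N : nat) :
  (forall l, l \in L -> l.2 = sgn l.1) -> (forall i, lt 1 (x i)) ->
  N \in map fst L ->
  (forall i, i \in map fst L -> i != N -> forall k, lt (x i ^+ k) (x N)) -> False.
Proof.
move=> Lsgn x1 NL dom.
have /eqP := level_sum_indicator_neq0 R Lsgn NL; apply.
apply: (growth_conj_prod (x1 N)) => l lL.
case: eqP => [->|/eqP lN].
  by split; [apply: powbounded_base|rewrite growth_base].
apply: growth_negligible => // [|k]; first exact: bo_ltW.
by apply/bo_ltW/dom => //; apply: map_f.
Qed.

Definition dominated g h := forall k, lt (g ^+ k) h.

Lemma dominated_trans h f g : dominated f h -> dominated h g -> dominated f g.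
Proof. by move=> fh hg k; apply: (bo_trans lt_biorder) (fh k) (hg 1%N). Qed.

Lemma dominatedJ t g h : dominated g h -> dominated (g ^ t) (h ^ t).
Proof. by move=> gh k; rewrite -conjXg; apply: bo_ltJ. Qed.

Lemma conj_gen_gt1 : lt 1 (b / a) -> forall i, lt 1 (x i).
Proof. by move=> ba1 i; rewrite -(conj1g (a^-1 ^+ i)); apply: bo_ltJ. Qed.

(** If x_0 and x_1 bound each other by powers, conjugation by a multiplies growth
    by a positive factor lam, and the growth of the trivial product is the sum in
    the conclusion.  Otherwise the x_i grow or decrease so fast with i that the
    highest or the lowest level dominates the product. *)
Lemma positive_eigenvalue (sgn : nat -> bool) :
  (forall l, l \in L -> l.2 = sgn l.1) -> L <> [::] -> lt 1 (b / a) ->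
  exists2 lam : R, (0 < lam)%R & level_sum (fun i => lam ^+ i)%R L = 0%R.
Proof.
move=> Lsgn L0 ba1; have x1 := conj_gen_gt1 ba1.
have ltn_tot (i j : nat) : i != j -> (i < j)%N \/ (j < i)%N by lia.
have ltn_tr (j i k : nat) : (i < j)%N -> (j < k)%N -> (i < k)%N by apply: ltn_trans.
have ba_x0 : x 0 = b / a by rewrite /conj_gen conjg1.
case: (pselect (dominated (x 0) (x 1))) => [up|not_up].
  have /homo_ltn {}up : forall i, dominated (x i) (x i.+1).
    by elim=> // i /(dominatedJ a^-1); rewrite -!conj_genS.
  have [N NL maxN] := maximal_level L0 ltn_tot ltn_tr.
  exfalso; apply: (no_dominant_level Lsgn x1 NL) => i iL iN.
  by apply: up (maxN _ iL iN) => g f h; apply: dominated_trans.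
case: (pselect (dominated (x 1) (x 0))) => [down|not_down].
  have {}down : forall i j, (i < j)%N -> dominated (x j) (x i).
    apply: (@homo_ltn _ x (fun g h => dominated h g)).
      by move=> g f h fg gh; apply: dominated_trans gh fg.
    by elim=> // i /(dominatedJ a^-1); rewrite -!conj_genS.
  have [||N NL minN] := @maximal_level L (fun i j => (j < i)%N) L0.
  - by move=> i j /ltn_tot [|]; [right|left].
  - by move=> j i k ji kj; apply: ltn_tr ji.
  exfalso; apply: (no_dominant_level Lsgn x1 NL) => i iL iN.
  exact/down/minN.
have [k xk] : exists k, le lt (x 1) (x 0 ^+ k).
  apply: contrapT => nex; apply: not_up => k.
  by case: (bo_total lt_biorder (x 1) (x 0 ^+ k)) => // xk; case: nex; exists k.
have [j xj] : exists j, le lt (x 0) (x 1 ^+ j).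
  apply: contrapT => nex; apply: not_down => j.
  by case: (bo_total lt_biorder (x 0) (x 1 ^+ j)) => // xj; case: nex; exists j.
have x0b := powbounded_base lt (x 0).
have x1b : powbounded lt (x 0) (x 0 ^ a^-1).
  by rewrite -conj_genS; apply: powbounded_le xk => //; apply: bo_ltW.
pose lam := growth lt R (x 0) (x 0 ^ a^-1).
have xlam i : powbounded lt (x 0) (x i) /\ growth lt R (x 0) (x i) = (lam ^+ i)%R.
  elim: i => [|i [xb xg]]; first by split=> //; rewrite growth_base.
  rewrite conj_genS exprS -xg; split; first exact: powboundedJ.
  exact: growthJ.
exists lam; last by apply: (growth_conj_prod (x1 0%N)) => l _; apply: xlam.
have := growth_mono lt_biorder R (x1 0%N) x0b (powboundedX lt_biorder j (xlam 1%N).1) xj.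
rewrite growthX ?growth_base ?(xlam 1%N).2 ?(xlam 1%N).1 //; last exact: (xlam 1%N).1.
rewrite expr1; case: (ltP 0%R lam) => // lam0 one_le.
have : (j%:R * lam <= 0)%R by apply: mulr_ge0_le0.
by lra.
Qed.

End ConjGenerators.

(** * Fox derivatives *)

Section FoxDerivative.
Local Open Scope ring_scope.
Local Notation K := {fraction {poly int}}.

Lemma tvar_neq0 : tvar != 0.
Proof. by rewrite tofrac_eq0 polyX_eq0. Qed.

Lemma tvar_neq1 : tvar != 1.
Proof.
rewrite -(rmorph1 (@tofrac _)) tofrac_eq -subr_eq0 -size_poly_eq0.
by rewrite -polyC1 size_XsubC.
Qed.

Lemma fox_deriv_levels h (u : word 2) : (size u <= h)%N ->
  tvar ^+ h * fox_deriv gen_b u = tofrac (level_sum (fun i => 'X^i) (b_levels h u)).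
Proof.
have t0 := tvar_neq0.
elim: u h => [|[i s] u IH] h uh.
  by rewrite mulr0 /level_sum big_nil rmorph0.
have Xt k : tofrac 'X^k = tvar ^+ k by rewrite rmorphXn.
have uh' : (size u <= h.+1)%N by rewrite ltnW // ltnW.
rewrite /level_sum /=; case: s uh => /=.
  case: h {uh'} => // h uh /=; rewrite big_cat rmorphD /= -[X in _ + tofrac X]/(level_sum _ _).
  rewrite -IH // mulrDr; congr (_ + _); last by rewrite exprSr -!mulrA mulVKf.
  case: (i == _); rewrite ?big_seq1 ?big_nil ?rmorph0 ?oppr0 ?mul0r ?mulr0 //=.
  by rewrite expr1 !mulN1r rmorphN /= Xt exprSr mulrN mulfK.
move=> uh; rewrite big_cat rmorphD /= -[X in _ + tofrac X]/(level_sum _ _) -IH //.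
rewrite mulrDr mulrA -exprSr; congr (_ + _).
by case: (i == _); rewrite ?big_seq1 ?big_nil ?rmorph0 ?mulr0 //= mul1r Xt mulr1.
Qed.

Lemma fox_fundamental_pos (F : fieldType) (t f z y : F) :
  t * z * ((t - 1) * f) = y - t * z ->
  z * ((t - 1) * (1 + t * f)) = y - z.
Proof. by move=> yE; rewrite -[y](subrK (t * z)) -yE; ring. Qed.

Lemma fox_fundamental_neg (F : fieldType) (t f z y : F) : t != 0 ->
  z * ((t - 1) * f) = y - z ->
  t * z * ((t - 1) * (- t^-1 + t^-1 * f)) = y - t * z.
Proof. by move=> t0 yE; rewrite -[y](subrK z) -yE; field. Qed.

(** The telescoping identity of Fox calculus, multiplied by t^h so that both
    powers of t have natural exponents. *)
Lemma fox_fundamental h (u : word 2) : (size u <= h)%N ->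
  tvar ^+ h * ((tvar - 1) * (fox_deriv gen_a u + fox_deriv gen_b u))
  = tvar ^+ final_height h u - tvar ^+ h.
Proof.
elim: u h => [|[i s] u IH] h uh; first by rewrite /= addr0 !mulr0 subrr.
have uh' : (size u <= h.+1)%N by rewrite ltnW // ltnW.
have ab : (i == gen_a)%:R + (i == gen_b)%:R = 1 :> K.
  by case: i {uh} => [[|[|//]] ?]; rewrite -!val_eqE /= ?addr0 ?add0r.
rewrite /=; case: s uh => /=.
  case: h {uh'} => // h uh /=.
  rewrite addrACA -mulrDl -mulrDr -opprD ab mulN1r exprS.
  exact: fox_fundamental_neg tvar_neq0 (IH h uh).
move=> uh; rewrite addrACA -mulrDr ab; apply: fox_fundamental_pos.
by rewrite -exprS; apply: IH.
Qed.

Lemma laurent_of_shift h (d : K) (Q : {poly int}) :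
  tvar ^+ h * d = tofrac Q -> laurent d.
Proof.
move=> dQ; exists Q, h; rewrite -dQ.
by rewrite [tvar ^+ h * d]mulrC mulfK // expf_neq0 // tvar_neq0.
Qed.

Lemma laurent_sign (s : bool) : laurent ((-1) ^+ s).
Proof.
exists ((-1) ^+ s), 0%N; rewrite (rmorph_sign (@tofrac _)).
by rewrite expr0 invr1 mulr1.
Qed.

(** As lam is nonzero, multiplying by powers of t does not affect roots at
    lam, so that divisibility of Laurent polynomials transports them. *)
Lemma root_laurent_dvd (F : numFieldType) h (d : K) (Q D : {poly int}) (lam : F) :
  tvar ^+ h * d = tofrac Q -> laurent_dvd d (tofrac D) -> 0 < lam ->
  root (map_poly intr Q) lam -> root (map_poly intr D) lam.
Proof.
move=> dQ [_ [s [k ->]] Ds] lam0 Qlam.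
have {dQ} Ds : D * 'X^(k + h) = s * Q.
  apply/eqP; rewrite -tofrac_eq; apply/eqP.
  rewrite tofracM tofracXn tofracM Ds -dQ exprD -/tvar.
  by rewrite mulrACA divfK ?expf_neq0 ?tvar_neq0 // [d * _]mulrC.
have lamX : ('X^(k + h)).[lam] != 0 by rewrite hornerXn expf_neq0 // gt_eqF.
rewrite rootE; apply/eqP/(mulIf lamX); rewrite mul0r -hornerM.
have := congr1 (fun f => (map_poly (intr : int -> F) f).[lam]) Ds.
rewrite /= !rmorphM /= map_polyXn => ->.
by rewrite hornerM (rootP Qlam) mulr0.
Qed.

Lemma horner_level_sum (A : comNzRingType) (x : A) L :
  (map_poly intr (level_sum (fun i => 'X^i : {poly int}) L)).[x]
  = level_sum (fun i => x ^+ i) L.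
Proof.
rewrite /level_sum rmorph_sum horner_sum; apply: eq_bigr => l _.
rewrite /= rmorphM rmorph_sign /= map_polyXn -polyC1 -polyCN -polyC_exp hornerCM.
by rewrite hornerXn.
Qed.

End FoxDerivative.

(** * Two-bridge presentations *)

Section Dihedral.
Variable q : nat.
Hypothesis q_gt1 : (1 < q)%N.
Local Open Scope ring_scope.

Fixpoint reflections (g : seq 'I_2) (s : 'Z_q) : 'Z_q :=
  if g is i :: g' then (i == gen_b)%:R - reflections g' s else s.

(** The generators act on Z/q as the reflections s |-> - s and s |-> 1 - s, so that
    the signs of the exponents do not matter. *)
Definition dihedral_act (u : word 2) : 'Z_q -> 'Z_q := reflections (map fst u).

Lemma reflections_cat g g' s : reflections (g ++ g') s = reflections g (reflections g' s).
Proof. by elim: g => //= i g ->. Qed.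

Lemma reflections_alternating n k s : ~~ odd k ->
  reflections [seq gen_at i | i <- iota k n.*2] s = s - n%:R.
Proof.
elim: n k => [|n IH] k ek; first by rewrite subr0.
by rewrite doubleS /= IH ?negbK //= /gen_at /= (negbTE ek) /= -natr1; ring.
Qed.

End Dihedral.

Section TwoBridge.
Variables p q : nat.
Hypotheses (q_gt1 : (1 < q)%N) (q_odd : odd q).
Local Notation P := (two_bridge_pres p q).

Definition two_bridge_relator : word 2 :=
  ((gen_a, false) :: two_bridge_word p q)
    ++ word_inv (rcons (two_bridge_word p q) (gen_b, false)).
Local Notation r := two_bridge_relator.

(** The relator is a w b^-1 w^-1, where w alternates, begins with b^(+-1) and ends
    with a^(+-1); so b^-1 and then w^-1 continue the alternation of a w. *)
Lemma two_bridge_relator_gens :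
  map fst r = [seq gen_at i | i <- iota 0 q.*2].
Proof.
have q_gt0 : (0 < q)%N by lia.
have w_gens : map fst (two_bridge_word p q) = [seq gen_at i | i <- iota 1 q.-1].
  by rewrite /two_bridge_word -map_comp; apply: eq_map.
have wb_gens : map fst (rcons (two_bridge_word p q) (gen_b, false))
    = [seq gen_at i | i <- iota 1 q].
  have -> : iota 1 q = rcons (iota 1 q.-1) q.
    by case: (q) q_gt0 => // n _; rewrite -[n.+1]addn1 iotaD cats1 addn1.
  by rewrite !map_rcons w_gens /gen_at q_odd.
rewrite /r map_cat /= w_gens /word_inv map_rev -map_comp.
have -> : map (fst \o @letter_inv 2) (rcons (two_bridge_word p q) (gen_b, false))
    = map fst (rcons (two_bridge_word p q) (gen_b, false)) by apply: eq_map.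
rewrite wb_gens -addnn iotaD map_cat.
have -> : [seq gen_at i | i <- iota 0 q] = gen_a :: [seq gen_at i | i <- iota 1 q.-1].
  by rewrite -{1}(prednK q_gt0).
rewrite cat_cons; congr (_ :: (_ ++ _)); apply: (@eq_from_nth _ gen_a).
  by rewrite size_rev !size_map !size_iota.
move=> i; rewrite size_rev size_map size_iota => iq.
rewrite nth_rev ?size_map ?size_iota // !(nth_map 0%N) ?size_iota //; last by lia.
rewrite !nth_iota //; last by lia.
by rewrite /gen_at; congr (if _ then _ else _); lia.
Qed.

Lemma two_bridge_relator_size : size r = q.*2.
Proof. by rewrite -(size_map fst) two_bridge_relator_gens size_map size_iota. Qed.

Lemma two_bridge_final_height h : (q.*2 <= h)%N -> final_height h r = h.
Proof.
move=> qh; have := @final_height_count h r; rewrite two_bridge_relator_size => /(_ qh).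
rewrite /r !count_cat /word_inv !count_rev !count_map -!cats1 !count_cat /=.
rewrite (@eq_count _ (preim _ snd) (fun l => ~~ l.2)) //.
rewrite (@eq_count _ (preim _ (fun l => ~~ l.2)) snd); last by move=> l /=; rewrite negbK.
by lia.
Qed.

(** Up to signs of exponents the relator is (a b)^q, where a b acts on Z/q as the
    translation by -1; so the action factors through the group, and it separates
    a from b. *)
Lemma two_bridge_meridians_neq :
  @class_of_word P [:: (gen_a, false)] <> @class_of_word P [:: (gen_b, false)].
Proof.
move/class_of_wordP => ab.
have act_eq u v : word_eq (P := P) u v -> @dihedral_act q u =1 @dihedral_act q v.
  elim=> {u v} [u|u v _ IH|u v w _ IH1 _ IH2|u v l|u v r' rP] s //.
  - by rewrite IH1.
  - by rewrite /dihedral_act !map_cat !reflections_cat /= subKr.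
  rewrite /dihedral_act !map_cat !reflections_cat; congr (reflections _ _).
  move: rP; rewrite inE => /eqP ->.
  rewrite two_bridge_relator_gens reflections_alternating //.
  by rewrite (pchar_Zp q_gt1) subr0.
have := act_eq _ _ ab 0%R; rewrite /dihedral_act /= !subr0 => /eqP.
by rewrite eq_sym oner_eq0.
Qed.

Lemma class_of_word_val u : @class_of_word P u
  = word_val (@class_of_word P [:: (gen_a, false)]) (@class_of_word P [:: (gen_b, false)]) u.
Proof.
elim: u => [//|[i s] u IH] /=; rewrite -IH.
have -> : gen_val (@class_of_word P [:: (gen_a, false)])
   (@class_of_word P [:: (gen_b, false)]) i = @class_of_word P [:: (i, false)].
  rewrite /gen_val; case: eqP => [->//|ib]; congr (@class_of_word P [:: (_, _)]).
  by case: i ib => [[|[|//]] ?] // ib; [apply/val_inj|case: ib; apply/val_inj].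
have mulE (v w : word 2) : (@class_of_word P v * @class_of_word P w)%g
  = @class_of_word P (v ++ w) := pg_mulE _ _.
case: s; last by rewrite mulE.
have -> : ((@class_of_word P [:: (i, false)])^-1)%g = @class_of_word P [:: (i, true)].
  exact: pg_invE.
by rewrite mulE.
Qed.

Lemma two_bridge_word_val_relator :
  word_val (@class_of_word P [:: (gen_a, false)]) (@class_of_word P [:: (gen_b, false)]) r = 1%g.
Proof.
rewrite -class_of_word_val; apply/class_of_wordP.
have := @word_eq_relator P [::] [::] r; rewrite /= cats0; apply.
by rewrite inE.
Qed.

(** The relator has height 0, so this is the fundamental identity. *)
Lemma two_bridge_fox_a : (fox_deriv gen_a r = - fox_deriv gen_b r)%R.
Proof.
have rq : (size r <= q.*2)%N by rewrite two_bridge_relator_size.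
have := fox_fundamental rq; rewrite two_bridge_final_height // subrr => /eqP.
rewrite mulf_eq0 expf_eq0 (negbTE tvar_neq0) andbF /=.
by rewrite mulf_eq0 subr_eq0 (negbTE tvar_neq1) addr_eq0 => /eqP.
Qed.

Lemma two_bridge_minor f g : @alexander_minor P f g = fox_deriv (g ord0) r.
Proof.
by rewrite /alexander_minor det_mx11 !mxE; case: (f ord0) => [[]].
Qed.

Lemma two_bridge_fox_dvd_minor f g :
  laurent_dvd (fox_deriv gen_b r) (@alexander_minor P f g).
Proof.
rewrite two_bridge_minor.
have [->|->] : g ord0 = gen_a \/ g ord0 = gen_b.
  by case: (g ord0) => [[|[|//]] ?]; [left|right]; apply/val_inj.
- exists ((-1) ^+ true)%R; first exact: laurent_sign.
  by rewrite two_bridge_fox_a expr1 mulN1r.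
- exists ((-1) ^+ false)%R; first exact: laurent_sign.
  by rewrite expr0 mul1r.
Qed.

End TwoBridge.

Theorem theorem3p3 (R : realType) (p q : nat) (D : {poly int})
    (p_gt0 : 0 < p) (p_lt_q : p < q) (p_odd : odd p) (q_odd : odd q)
    (coprime_pq : coprime p q)
    (D_alexander : is_alexander_poly (two_bridge_pres p q) D) :
  bi_orderable (two_bridge_knot_group p q) ->
  exists x : R, (0 < x)%R /\ root (map_poly intr D) x.
Proof.
move=> [lt0 lt0_biorder]; have q_gt1 : 1 < q by lia.
pose r := two_bridge_relator p q.
pose a : two_bridge_knot_group p q :=
  @class_of_word (two_bridge_pres p q) [:: (gen_a, false)].
pose b : two_bridge_knot_group p q :=
  @class_of_word (two_bridge_pres p q) [:: (gen_b, false)].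
have [lt lt_biorder ba1] : exists2 lt, biorder lt & lt 1%g (b / a)%g.
  have [[ba1|/divg1_eq ba]|ba1] := bo_total lt0_biorder (b / a)%g 1%g.
  - by exists (fun g h => lt0 h g) => //; apply: biorder_converse.
  - by case: (@two_bridge_meridians_neq p q q_gt1 q_odd).
  - by exists lt0.
(* Starting at a height no smaller than the length of the relator keeps all the
   heights, which are natural numbers, away from truncation. *)
pose h := q.*2; pose L := b_levels h r.
have rh : size r <= h by rewrite two_bridge_relator_size.
have Lprod : conj_prod a b L = 1%g.
  have := word_val_levels a b rh; rewrite two_bridge_final_height // -/L.
  by rewrite two_bridge_word_val_relator mulg1 -[X in X = _]mul1g => /mulIg.
have Lsgn l : l \in L -> l.2 = ~~ odd (l.1 + h + 0).
  apply: b_levels_sign => //.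
  by rewrite two_bridge_relator_size // two_bridge_relator_gens.
have L0 : L <> [::].
  suff : 0 < size L by case: (L).
  rewrite size_b_levels -has_count; apply/hasP; exists (gen_b, true) => //.
  by rewrite mem_cat /word_inv map_rcons rev_rcons mem_head orbT.
have [lam lam0 rootL] := positive_eigenvalue R lt_biorder Lprod
  (sgn := fun i => ~~ odd (i + h + 0)) Lsgn L0 ba1.
have dL := fox_deriv_levels rh.
exists lam; split=> //; apply: (root_laurent_dvd dL) => //.
  apply: D_alexander.2; first exact: laurent_of_shift dL.
  exact: two_bridge_fox_dvd_minor.
by rewrite rootE horner_level_sum rootL.
Qed.
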